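(* Let $\mathfrak g$ be a $4n$-dimensional real almost Abelian Lie algebra with a codimension one Abelian ideal $\mathfrak u$, and let $(J,\omega)$ be an $\mathrm{Sp}(2n,\mathbb C)$-structure on $\mathfrak g$. Consider some complement $\mathfrak u'$ of $\mathfrak u^{\perp_\omega}$ in $\mathfrak u$ which contains $J\mathfrak u^{\perp_\omega}$ and set $\mathfrak u'_J:=\mathfrak u'\cap J\mathfrak u'$. Take also $X\in\mathfrak g\setminus\mathfrak u$ such that $X\in(\mathfrak u')^{\perp_\omega}$ and $$\mathfrak u=\mathfrak u'_J\oplus\mathfrak u^{\perp_\omega}\oplus J\mathfrak u^{\perp_\omega}\oplus\mathrm{span}(JX).$$ Let $\omega'_J$ be the restriction of $\omega$ to $\mathfrak u'_J$ and let $f:=\operatorname{ad}_X|_{\mathfrak u}$. If we choose $Y\in\mathfrak u^{\perp_\omega}\setminus\{0\}$ with $\omega(JY,JX)=1$, then $$(\mathfrak g,J,\omega)=(\mathfrak u'_J,J|_{\mathfrak u'_J},\omega'_J)\oplus(V,J|_V,\omega_V)$$ as complex symplectic vector spaces, for $$V:=\mathfrak u^{\perp_\omega}\oplus J\mathfrak u^{\perp_\omega}\oplus\mathrm{span}(JX,X)=\mathrm{span}(Y,JY,JX,X),\qquad \omega_V:=J^*\alpha\wedge J^*\beta-\alpha\wedge\beta,$$ where $\alpha,-J^*\alpha,\beta,-J^*\beta\in\mathfrak g^*$ span the annihilator $(\mathfrak u'_J)^0\cong V^*$ of $\mathfrak u'_J$ and are the dual basis of $(Y,JY,X,JX)$.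 Moreover, $(J,\omega)$ is a complex symplectic structure on $\mathfrak g$ if and only if there exist $a,b,c\in\mathbb R$, $u\in\mathfrak u'_J$ and $f'_J\in\mathfrak{sp}(\mathfrak u'_J,\omega'_J,J)$ such that $$f=\begin{pmatrix} f'_J & \mathbf 0 & \mathbf 0 & u\\ \omega(Ju,\cdot) & a & 0 & b\\ \omega(u,\cdot) & 0 & a & c\\ \mathbf 0 & 0 & 0 & -a\end{pmatrix}$$ with respect to the splitting $\mathfrak u=\mathfrak u'_J\oplus\mathfrak u^{\perp_\omega}\oplus J\mathfrak u^{\perp_\omega}\oplus\mathrm{span}(JX)$ and to the basis $\{Y,JY,JX\}$ of $\mathfrak u^{\perp_\omega}\oplus J\mathfrak u^{\perp_\omega}\oplus\mathrm{span}(JX)$.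
   Context: A real Lie algebra is almost Abelian if it has a codimension one Abelian ideal. An $\mathrm{Sp}(2n,\mathbb C)$-structure on a $4n$-dimensional Lie algebra $\mathfrak g$ is a pair $(J,\omega)$ of an almost complex structure $J$ ($J\in\operatorname{End}(\mathfrak g)$, $J^2=-\mathrm{Id}$) and a non-degenerate two-form $\omega\in\Lambda^2\mathfrak g^*$ such that $J$ is symmetric with respect to $\omega$: $\omega(JX,Y)=\omega(X,JY)$ for all $X,Y$. A complex symplectic vector space is a real vector space with such a pair $(J,\omega)$. The pair $(J,\omega)$ is a complex symplectic structure on $\mathfrak g$ if, in addition, $J$ is integrable, i.e. $N_J(X,Y)=[X,Y]+J[JX,Y]+J[X,JY]-[JX,JY]$ vanishes, and $d\omega=0$, where $d$ is the Chevalley–Eilenberg differential determined by $(d\alpha)(X,Y)=-\alpha([X,Y])$. For a subspace $W\subset\mathfrak g$, $W^{\perp_\omega}=\{Z\in\mathfrak g\mid\omega(Z,U)=0\ \forall\,U\in W\}$. It holds that $\mathfrak u^{\perp_\omega}$ is one-dimensional and that $\mathfrak u^{\perp_\omega}$ and $J\mathfrak u^{\perp_\omega}$ are contained in $\mathfrak u\cap J\mathfrak u$. For $\gamma\in\mathfrak g^*$, $(J^*\gamma)(Z)=\gamma(JZ)$. Finally, $\mathfrak{sp}(\mathfrak u'_J,\omega'_J,J)$ is the set of endomorphisms $h$ of $\mathfrak u'_J$ with $hJ=Jh$ and $\omega'_J(hZ,W)+\omega'_J(Z,hW)=0$ for all $Z,W\in\mathfrak u'_J$. *)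

(* Defs.v *)
From HB Require Import structures.
From mathcomp Require Import all_boot all_order all_algebra.
From mathcomp Require Import ring.
From mathcomp Require Import reals.

Set Implicit Arguments.
Unset Strict Implicit.
Unset Printing Implicit Defensive.

Import GRing.Theory.
Local Open Scope ring_scope.

Record lie_bracket (R : fieldType) (g : vectType R) := LieBracket {
  lie_br :> {bilinear g -> g -> g};
  lie_alt : forall x, lie_br x x = 0;
  lie_jacobi : forall x y z,
    lie_br x (lie_br y z) + lie_br y (lie_br z x) + lie_br z (lie_br x y) = 0
}.

Definition ad (R : fieldType) (g : vectType R) (br : lie_bracket g) (x : g) :
  'End(g) := linfun (br x).

Definition abelian_ideal (R : fieldType) (g : vectType R)
    (br : lie_bracket g) (u : {vspace g}) : Prop :=
  (forall x y, y \in u -> br x y \in u) /\ {in u &, forall x y, br x y = 0}.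

(** Two-forms are represented by [{skew_symmetric V}] (in characteristic other
    than 2, skew-symmetric and alternating bilinear forms coincide), and the
    subspace W^{perp_omega} is [orthov omega W]. *)

Section TwoForms.
Variables (R : fieldType) (V : vectType R).

Definition dual := 'Hom(V, R^o).

Definition pullback (J : 'End(V)) (c : dual) : dual := (c \o J)%VF.

Definition wedge (a b : dual) (x y : V) : R := a x * b y - a y * b x.

Fact wedge_bilinear a b :
  bilinear_for *%R (@idfun R \; *%R) (wedge a b).
Proof.
by split=> x k y z; rewrite /wedge /= !linearP /=;
  change (k *: a y : R^o) with (k * a y);
  change (k *: b y : R^o) with (k * b y); ring.
Qed.

HB.instance Definition _ a b :=
  bilinear_isBilinear.Build R V V R *%R (@idfun R \; *%R) (wedge a b)
    (wedge_bilinear a b).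

Fact wedge_skew a b x y :
  wedge a b x y = (-1) ^+ true * idfun (wedge a b y x).
Proof. by rewrite /wedge /= expr1; ring. Qed.

HB.instance Definition _ a b :=
  isHermitianSesquilinear.Build R V true idfun (wedge a b) (@wedge_skew a b).

Definition sub_form (w1 w2 : {skew_symmetric V}) (x y : V) : R :=
  w1 x y - w2 x y.

Fact sub_form_bilinear w1 w2 :
  bilinear_for *%R (@idfun R \; *%R) (sub_form w1 w2).
Proof.
by split=> x k y z; rewrite /sub_form /=;
  rewrite ?linearPl ?linearPr /=; ring.
Qed.

HB.instance Definition _ w1 w2 :=
  bilinear_isBilinear.Build R V V R *%R (@idfun R \; *%R) (sub_form w1 w2)
    (sub_form_bilinear w1 w2).

Fact sub_form_skew w1 w2 x y :
  sub_form w1 w2 x y = (-1) ^+ true * idfun (sub_form w1 w2 y x).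
Proof.
by rewrite /sub_form /= (hermC w1 x y) (hermC w2 x y) /= expr1; ring.
Qed.

HB.instance Definition _ w1 w2 :=
  isHermitianSesquilinear.Build R V true idfun (sub_form w1 w2)
    (@sub_form_skew w1 w2).

Definition restr_form (w : {skew_symmetric V}) (U : {vspace V})
  (x y : subvs_of U) : R := w (vsval x) (vsval y).

Fact restr_form_bilinear w U :
  bilinear_for *%R (@idfun R \; *%R) (@restr_form w U).
Proof.
by split=> x k y z; rewrite /restr_form linearP /= ?linearPl ?linearPr.
Qed.

HB.instance Definition _ w U :=
  bilinear_isBilinear.Build R (subvs_of U) (subvs_of U) R *%R
    (@idfun R \; *%R) (@restr_form w U) (restr_form_bilinear w U).

Fact restr_form_skew w U x y :
  @restr_form w U x y = (-1) ^+ true * idfun (@restr_form w U y x).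
Proof. exact: hermC. Qed.

HB.instance Definition _ w U :=
  isHermitianSesquilinear.Build R (subvs_of U) true idfun (@restr_form w U)
    (@restr_form_skew w U).

End TwoForms.

Arguments restr_form {R V} w U.

(** [vsproj U] is the identity on [U]: when [f] maps [U] into itself,
    [restr_end U f] is the restriction of [f] to [U] (see [restr_endE]). *)
Definition restr_end (R : fieldType) (V : vectType R) (U : {vspace V})
    (f : 'End(V)) : 'End(subvs_of U) :=
  linfun (vsproj U \o (f \o vsval)).

Lemma restr_endE (R : fieldType) (V : vectType R) (U : {vspace V})
    (f : 'End(V)) (x : subvs_of U) :
  (f @: U <= U)%VS -> vsval (restr_end U f x) = f (vsval x).
Proof.
move=> fU; rewrite lfunE /= vsprojK //.
by apply: (subvP fU); rewrite memv_img ?subvsP.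
Qed.

(** On a Lie algebra of dimension 4n, this is an Sp(2n, C)-structure. *)
Definition complex_symplectic_space (R : fieldType) (V : vectType R)
    (J : 'End(V)) (w : {skew_symmetric V}) : Prop :=
  [/\ (J \o J)%VF = - \1%VF,
      nondegenerate w
    & forall x y, w (J x) y = w x (J y)].

(** (V, J, w) = (U, J|U, wU) (+) (W, J|W, wW) as complex symplectic spaces. *)
Definition complex_symplectic_direct_sum (R : fieldType) (V : vectType R)
    (J : 'End(V)) (w : {skew_symmetric V}) (U W : {vspace V})
    (wU : {skew_symmetric (subvs_of U)})
    (wW : {skew_symmetric (subvs_of W)}) : Prop :=
  [/\ directv (U + W)%VS /\ (U + W)%VS = fullv,
      (J @: U <= U)%VS /\ (J @: W <= W)%VS,
      complex_symplectic_space (restr_end U J) wU,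
      complex_symplectic_space (restr_end W J) wW
    & forall (x x' : subvs_of U) (y y' : subvs_of W),
        w (vsval x + vsval y) (vsval x' + vsval y') = wU x x' + wW y y'].

Definition nijenhuis (R : fieldType) (g : vectType R) (br : lie_bracket g)
    (J : 'End(g)) (x y : g) : g :=
  br x y + J (br (J x) y) + J (br x (J y)) - br (J x) (J y).

Definition ce_diff1 (R : fieldType) (g : vectType R) (br : lie_bracket g)
  (a : dual g) (x y : g) : R := - a (br x y).

(** The extension of [ce_diff1] to two-forms as a graded derivation, see
    [ce_diff2_wedge]. *)
Definition ce_diff2 (R : fieldType) (g : vectType R) (br : lie_bracket g)
    (w : {skew_symmetric g}) (x y z : g) : R :=
  - w (br x y) z + w (br x z) y - w (br y z) x.

(** d(a /\ b) = da /\ b - a /\ db *)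
Lemma ce_diff2_wedge (R : fieldType) (g : vectType R) (br : lie_bracket g)
    (a b : dual g) (x y z : g) :
  let d := ce_diff1 br in
  ce_diff2 br (wedge a b) x y z =
    (d a x y * b z - d a x z * b y + d a y z * b x)
    - (a x * d b y z - a y * d b x z + a z * d b x y).
Proof. by rewrite /ce_diff2 /ce_diff1 /= /wedge; ring. Qed.

Definition complex_symplectic_structure (R : fieldType) (g : vectType R)
    (br : lie_bracket g) (J : 'End(g)) (w : {skew_symmetric g}) : Prop :=
  [/\ complex_symplectic_space J w,
      forall x y, nijenhuis br J x y = 0
    & forall x y z, ce_diff2 br w x y z = 0].

Definition in_sp (R : fieldType) (V : vectType R) (w : {skew_symmetric V})
    (J h : 'End(V)) : Prop :=
  (h \o J)%VF = (J \o h)%VF /\ forall x y, w (h x) y + w x (h y) = 0.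

Definition spans_annihilator (R : fieldType) (V : vectType R)
    (U : {vspace V}) (s : seq (dual V)) : Prop :=
  forall c : dual V, c \in <<s>>%VS <-> {in U, forall x, c x = 0}.

Definition dual_family (R : fieldType) (V : vectType R) (m : nat)
    (e : m.-tuple V) (c : m.-tuple (dual V)) : Prop :=
  forall i j : 'I_m, tnth c i (tnth e j) = (i == j)%:R.

(** The endomorphism [f] of [u] has, with respect to the splitting
    u = U (+) <[Y]> (+) <[JY]> (+) <[JX]>, the block matrix
<<
        h      0  0   p
     w(Jp, .)  a  0   b
     w(p, .)   0  a   c
        0      0  0  -a
>>
    acting on column vectors (z, r, s, t) with [z] in U. *)
Definition has_block_matrix (R : fieldType) (g : vectType R)
    (J : 'End(g)) (w : {skew_symmetric g}) (u U : {vspace g}) (X Y : g)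
    (f : 'End(subvs_of u)) (a b c : R) (p : subvs_of U)
    (h : 'End(subvs_of U)) : Prop :=
  forall (v : subvs_of u) (z : subvs_of U) (r s t : R),
    vsval v = vsval z + r *: Y + s *: J Y + t *: J X ->
    vsval (f v) =
      (vsval (h z) + t *: vsval p)
      + (w (J (vsval p)) (vsval z) + a * r + b * t) *: Y
      + (w (vsval p) (vsval z) + a * s + c * t) *: J Y
      + (- a * t) *: J X.

(* Main.v *)
From HB Require Import structures.
Require Import Defs.
From mathcomp Require Import all_boot all_order all_algebra.
From mathcomp Require Import ring.
From mathcomp Require Import reals.

Set Implicit Arguments.
Unset Strict Implicit.
Unset Printing Implicit Defensive.

Import GRing.Theory.
Local Open Scope ring_scope.

(** Splitting.  Since u is a hyperplane, its omega-orthogonal is a line; the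
    normalisation omega(JY, JX) = 1 reads omega(Y, X) = -1, and the symmetry
    of J makes every omega(x, Jx) vanish.  Together with omega(Y, JX) = 0
    this determines all sixteen pairings among Y, JY, X, JX
    ([frame_pairings]): they form a symplectic frame, with span V.  Hence g is
    the orthogonal sum of V and its orthogonal, and the coefficients of the
    projection to V are themselves pairings with frame vectors
    ([frame_proj]).  The dual covectors are thus al = omega(X, .) and
    be = - omega(Y, .), and the whole first half is linear algebra of this
    projection ([frame_basis], [frame_dual_family],
    [frame_spans_annihilator], [frame_direct_sum]).  What ties it to the
    given data is that u'J is exactly the orthogonal of V, by a comparison of
    coefficients ([complement_orth_frame]).

    Integrability.  As u is an abelian ideal and g = u + RX, the bracket is
    encoded by ad X on u.  Then d omega = 0 says that ad X is skew for the
    restriction of omega to u ([closed_iff_ad_skew]), and N_J = 0 says that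
    ad X commutes with J on the intersection of u and Ju
    ([integrable_iff_ad_comm]).

    Normal form.  It remains to see that an endomorphism F of u has these two
    properties exactly when it has the block form.  Skewness makes F preserve
    the radical RY of omega on u, so F Y = aY, and commutation gives
    F(JY) = aJY.  All other entries are read off by pairing with the frame
    and moving F across omega: the entry -a comes from the pairing of F(JX)
    with JY, and the rows omega(Jp, .) and omega(p, .) from the
    component p of F(JX) orthogonal to the frame
    ([block_matrix_necessary]).  The converse is a direct expansion
    ([block_matrix_sufficient]).

    Equalities of vectors are often proved by pairing both sides with an
    arbitrary vector ([cs_inj]), which turns them into ring identities. *)

(** * Skew-symmetric forms and covectors *)

Section SkewForm.
Variables (R : fieldType) (V : vectType R) (w : {skew_symmetric V}).

Lemma skewC x y : w x y = - w y x.
Proof. by rewrite hermC /= expr1 mulN1r. Qed.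

Lemma skew_xx x : (2 : R) != 0 -> w x x = 0.
Proof.
move=> char2; apply: (mulfI char2).
by rewrite mulr0 mulr_natl mulr2n {1}skewC addNr.
Qed.

(** The arithmetic of a form, with scalars coming out as ring products so that
    [ring] applies to the result. *)
Lemma skewDl x y z : w (x + y) z = w x z + w y z.
Proof. exact: linearDl. Qed.

Lemma skewDr x y z : w z (x + y) = w z x + w z y.
Proof. exact: linearDr. Qed.

Lemma skewZl k x z : w (k *: x) z = k * w x z.
Proof. exact: linearZl_LR. Qed.

Lemma skewZr k x z : w z (k *: x) = k * w z x.
Proof. exact: linearZr_LR. Qed.

Lemma skewNl x z : w (- x) z = - w x z.
Proof. exact: linearNl. Qed.

Lemma skewNr x z : w z (- x) = - w z x.
Proof. exact: linearNr. Qed.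

Definition skewE := (skewDl, skewDr, skewZl, skewZr, skewNl, skewNr).

Lemma nondegenerateP :
  reflect (forall x, (forall y, w x y = 0) -> x = 0) (nondegenerate w).
Proof.
apply: (iffP eqP) => [rad0 x x0 | rad0].
  by apply/eqP; rewrite -memv0 -rad0; apply/mem_orthovP => y _; apply: x0.
apply/eqP; rewrite -subv0; apply/subvP => x /mem_orthovP x0.
by rewrite memv0; apply/eqP/rad0 => y; apply/x0/memvf.
Qed.

(** Typed in [R^o] so that it is a linear map between modules and yields a
    covector. *)
Definition left_pairing (x v : V) : R^o := w x v.

Fact left_pairing_linear x : linear (left_pairing x).
Proof. by move=> k y z; rewrite /left_pairing skewDr skewZr. Qed.

HB.instance Definition _ x :=
  GRing.isLinear.Build R V R^o *:%R (left_pairing x) (left_pairing_linear x).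

Definition pairing_covector x : dual V := linfun (left_pairing x).

Lemma pairing_covectorE x v : pairing_covector x v = w x v.
Proof. by rewrite /pairing_covector lfunE. Qed.

End SkewForm.

(** Applying the [i]-th covector to a vanishing combination of the family
    isolates its [i]-th coefficient. *)
Lemma dual_family_free (R : fieldType) (V : vectType R) (m : nat)
    (e : m.-tuple V) (c : m.-tuple (dual V)) :
  dual_family e c -> free e.
Proof.
move=> dec; apply/freeP=> k ke0 i.
have : tnth c i (\sum_(j < m) k j *: e`_j) = 0 by rewrite ke0 linear0.
rewrite linear_sum (bigD1 i) //= big1 => [|j ji].
  rewrite linearZ /= -tnth_nth dec eqxx addr0 => /eqP.
  by rewrite mulf_eq0 oner_eq0 orbF => /eqP.
by rewrite linearZ /= -tnth_nth dec eq_sym (negbTE ji) scaler0.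
Qed.

Section Bracket.
Variables (R : fieldType) (g : vectType R) (br : lie_bracket g).

Lemma brDl x y z : br (x + y) z = br x z + br y z.
Proof. exact: linearDl. Qed.

Lemma brDr x y z : br z (x + y) = br z x + br z y.
Proof. exact: linearDr. Qed.

Lemma brZl k x z : br (k *: x) z = k *: br x z.
Proof. exact: linearZl_LR. Qed.

Lemma brZr k x z : br z (k *: x) = k *: br z x.
Proof. exact: linearZr_LR. Qed.

Lemma brNl x z : br (- x) z = - br x z.
Proof. exact: linearNl. Qed.

Lemma brNr x z : br z (- x) = - br z x.
Proof. exact: linearNr. Qed.

Definition brE := (brDl, brDr, brZl, brZr, brNl, brNr).

Lemma brC x y : br x y = - br y x.
Proof.
apply/eqP; rewrite -addr_eq0; apply/eqP.
by have := lie_alt br (x + y); rewrite !brE !lie_alt add0r addr0.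
Qed.

End Bracket.

(** * Complex symplectic spaces *)

Section ComplexSymplectic.
Variables (R : fieldType) (V : vectType R) (J : 'End(V)).
Variable w : {skew_symmetric V}.
Hypothesis Jw : complex_symplectic_space J w.

Lemma cs_JK x : J (J x) = - x.
Proof.
by case: Jw => JJ _ _; move/lfunP/(_ x): JJ; rewrite !lfunE /= !lfunE.
Qed.

Lemma cs_linear :
  (J 0 = 0) * (forall x y, J (x + y) = J x + J y) *
  (forall x, J (- x) = - J x) * (forall k x, J (k *: x) = k *: J x).
Proof.
do !apply: pair; first exact: linear0.
- exact: linearD.
- exact: linearN.
- by move=> k x; rewrite linearZ.
Qed.

Lemma cs_J x y : w (J x) y = w x (J y).
Proof. by case: Jw. Qed.

Lemma cs_eq0 x : (forall y, w x y = 0) -> x = 0.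
Proof. by case: Jw => _ /nondegenerateP + _; apply. Qed.

Lemma cs_inj x y : (forall t, w x t = w y t) -> x = y.
Proof.
move=> xy; apply/eqP; rewrite -subr_eq0; apply/eqP/cs_eq0 => t.
by rewrite !skewE xy subrr.
Qed.

(** By symmetry of [J] and skewness of [w], the value is its own opposite. *)
Lemma cs_xJx x : (2 : R) != 0 -> w x (J x) = 0.
Proof.
move=> char2; apply: (mulfI char2).
by rewrite mulr0 mulr_natl mulr2n {1}skewC cs_J addNr.
Qed.

(** A vector of [A] that pairs to zero with [A] also pairs to zero with the
    orthogonal complement [B], hence vanishes; this is how non-degeneracy
    passes to the summands of an orthogonal sum. *)
Lemma orth_restr_cs (A B : {vspace V}) (wA : {skew_symmetric (subvs_of A)}) :
  (A + B)%VS = fullv -> (J @: A <= A)%VS ->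
  {in A & B, forall x y, w x y = 0} ->
  (forall x y, wA x y = w (vsval x) (vsval y)) ->
  complex_symplectic_space (restr_end A J) wA.
Proof.
move=> AB JA orthAB wAE; split.
- apply/lfunP=> x; apply: subvs_inj.
  by rewrite !lfunE /= !restr_endE // cs_JK lfunE.
- apply/nondegenerateP=> x x0; apply/subvs_inj/cs_eq0 => y.
  have /memv_addP[a aA [b bB ->]] : y \in (A + B)%VS by rewrite AB memvf.
  have := x0 (vsproj A a); rewrite wAE vsprojK // skewE => ->.
  by rewrite orthAB ?subvsP ?addr0.
- by move=> x y; rewrite !wAE !restr_endE // cs_J.
Qed.

End ComplexSymplectic.

(** * The symplectic frame Y, JY, X, JX and its orthogonal *)

Section Frame.
Variables (R : fieldType) (g : vectType R) (J : 'End(g)).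
Variable w : {skew_symmetric g}.
Hypothesis Jw : complex_symplectic_space J w.
Hypothesis char2 : (2 : R) != 0.
Variables X Y : g.
Hypotheses (YX : w Y X = -1) (YJX : w Y (J X) = 0).

Let JK := cs_JK Jw.
Let wJ := cs_J Jw.

(** Moving [J] across [w] reduces each entry to one of [w x x], [w x (J x)],
    [w Y X] and [w Y (J X)].  The statement is a product of equations so that it
    can be used as a single rewrite rule. *)
Lemma frame_pairings :
  ((w Y Y = 0) * (w Y (J Y) = 0) * (w Y X = -1) * (w Y (J X) = 0)) *
  ((w (J Y) Y = 0) * (w (J Y) (J Y) = 0) * (w (J Y) X = 0) *
   (w (J Y) (J X) = 1)) *
  ((w X Y = 1) * (w X (J Y) = 0) * (w X X = 0) * (w X (J X) = 0)) *
  ((w (J X) Y = 0) * (w (J X) (J Y) = -1) * (w (J X) X = 0) *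
   (w (J X) (J X) = 0)).
Proof.
have xx x : w x x = 0 by exact: skew_xx.
have xJx x : w x (J x) = 0 by exact: cs_xJx.
have XY : w X Y = 1 by rewrite skewC YX opprK.
have XJY : w X (J Y) = 0 by rewrite -wJ skewC YJX oppr0.
do !apply: pair; rewrite ?xx ?wJ ?JK ?xJx ?skewNr ?YX ?YJX ?XY ?XJY ?xx;
by rewrite ?oppr0 ?opprK.
Qed.

Definition frame := [:: Y; J Y; X; J X].

Lemma mem_frame_orth v :
  v \in orthov w <<frame>> <->
    [/\ w Y v = 0, w (J Y) v = 0, w X v = 0 & w (J X) v = 0].
Proof.
rewrite mem_orthov_sym; split=> [/span_subvP sF | [e1 e2 e3 e4]].
  by split; apply/eqP; rewrite -mem_orthov1; apply: sF; rewrite !inE eqxx ?orbT.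
apply/span_subvP => x; rewrite !inE => /or4P[] /eqP->;
by rewrite mem_orthov1; apply/eqP.
Qed.

Let U := orthov w <<frame>>.

Lemma orth_frame z : z \in U ->
  ((w Y z = 0) * (w (J Y) z = 0) * (w X z = 0) * (w (J X) z = 0)) *
  ((w z Y = 0) * (w z (J Y) = 0) * (w z X = 0) * (w z (J X) = 0)).
Proof.
move=> /mem_frame_orth[zY zJY zX zJX].
by do !apply: pair => //; rewrite skewC ?zY ?zJY ?zX ?zJX oppr0.
Qed.

(** The orthogonal projection to the span of the frame; the signs are those of
    the Gram matrix in [frame_pairings]. *)
Definition frame_proj v :=
  w X v *: Y - w (J X) v *: J Y - w Y v *: X + w (J Y) v *: J X.

Lemma frame_proj_mem v : frame_proj v \in <<frame>>%VS.
Proof.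
by rewrite /frame_proj !(rpredD, rpredN, rpredZ) ?memv_span // !inE eqxx ?orbT.
Qed.

Lemma sub_frame_proj_orth v : v - frame_proj v \in U.
Proof.
apply/mem_frame_orth; split;
by rewrite /frame_proj !skewE !frame_pairings; ring.
Qed.

Lemma frame_proj_id v : v \in <<frame>>%VS -> frame_proj v = v.
Proof.
rewrite /frame !span_cons span_nil addv0.
case/memv_addP=> _ /vlineP[r ->] [y1 /memv_addP[_ /vlineP[s ->] [y2 + ->]] ->].
case/memv_addP=> _ /vlineP[q ->] [_ /vlineP[t ->] ->].
rewrite /frame_proj !skewE !frame_pairings.
rewrite !(mulr0, mulr1, mulrN1, addr0, add0r, oppr0, opprK, sub0r, scaleNr).
by rewrite ?addrA ?opprK.
Qed.

Lemma frame_proj0 z : z \in U -> frame_proj z = 0.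
Proof.
move=> zU; rewrite /frame_proj !(orth_frame zU).
by rewrite !scale0r !subr0 addr0.
Qed.

Lemma frame_direct : directv (U + <<frame>>)%VS.
Proof.
apply/directv_addP/eqP; rewrite -subv0; apply/subvP=> v /memv_capP[vU vF].
by rewrite memv0 -(frame_proj_id vF) frame_proj0.
Qed.

Lemma frame_full : (U + <<frame>>)%VS = fullv.
Proof.
apply/eqP; rewrite eqEsubv subvf; apply/subvP=> v _.
rewrite -(subrK (frame_proj v) v).
by rewrite memv_add ?sub_frame_proj_orth ?frame_proj_mem.
Qed.

Let al := pairing_covector w X.
Let be := - pairing_covector w Y.

Lemma pullback_pairingX v : pullback J al v = w (J X) v.
Proof. by rewrite /pullback lfunE /= pairing_covectorE wJ. Qed.

Lemma pullback_pairingY v : pullback J be v = - w (J Y) v.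
Proof. by rewrite /pullback lfunE /= opp_lfunE pairing_covectorE wJ. Qed.

Lemma frame_dual_family :
  dual_family [tuple Y; J Y; X; J X]
    [tuple al; - pullback J al; be; - pullback J be].
Proof.
case=> [[|[|[|[|//]]]] hi] [[|[|[|[|//]]]] hj];
rewrite !(tnth_nth 0) /= ?opp_lfunE ?pullback_pairingX ?pullback_pairingY;
by rewrite ?opp_lfunE ?pairing_covectorE !frame_pairings ?opprK ?oppr0.
Qed.

Lemma frame_basis : basis_of <<frame>> frame.
Proof.
by rewrite basisEfree subvv dim_span (dual_family_free frame_dual_family).
Qed.

(** A covector [c] that vanishes on [U] satisfies [c v = c (frame_proj v)], and
    the coefficients of [frame_proj] are the four covectors evaluated at [v]. *)
Lemma frame_spans_annihilator :
  spans_annihilator U [:: al; - pullback J al; be; - pullback J be].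
Proof.
move=> c; split=> [|c0].
  rewrite /frame !span_cons span_nil addv0.
  case/memv_addP=> _ /vlineP[r ->] [y1 /memv_addP[_ /vlineP[s ->] [y2 + ->]] ->].
  case/memv_addP=> _ /vlineP[q ->] [_ /vlineP[t ->] ->] z zU.
  rewrite !(add_lfunE, scale_lfunE, opp_lfunE).
  rewrite !(pullback_pairingX, pullback_pairingY, opp_lfunE, pairing_covectorE).
  by rewrite !(orth_frame zU) !(oppr0, scaler0, addr0).
suff -> : c = c Y *: al + c (J Y) *: - pullback J al + c X *: be
              + c (J X) *: - pullback J be.
  by rewrite !rpredD ?rpredZ ?memv_span // !inE eqxx ?orbT.
apply/lfunP=> v.
have := c0 _ (sub_frame_proj_orth v).
move/eqP; rewrite linearB subr_eq0 => /eqP ->.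
rewrite /frame_proj !(linearD, linearB, linearZ, linearN).
rewrite !(add_lfunE, scale_lfunE, opp_lfunE).
rewrite !(pullback_pairingX, pullback_pairingY, opp_lfunE, pairing_covectorE).
have sE (a b : R) : a *: (b : R^o) = a * b by [].
by rewrite /= !scalerN !sE; ring.
Qed.

Let wV := sub_form (wedge (pullback J al) (pullback J be)) (wedge al be).

(** Expanding [w] on the frame coordinates of [x] and [y], which are values of
    the dual covectors, gives the two wedge products. *)
Lemma frame_form x y :
  x \in <<frame>>%VS -> y \in <<frame>>%VS -> wV x y = w x y.
Proof.
move=> xF yF; rewrite -{2}(frame_proj_id xF) -{2}(frame_proj_id yF).
rewrite /frame_proj !skewE !frame_pairings /wV /= /sub_form /= /wedge.
rewrite !(opp_lfunE, pullback_pairingX, pullback_pairingY, pairing_covectorE).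
ring.
Qed.

Lemma frame_stable : (J @: <<frame>> <= <<frame>>)%VS.
Proof.
rewrite limg_span; apply/span_subvP=> x; rewrite /frame /= !JK !inE.
by case/or4P=> /eqP->; rewrite ?rpredN memv_span // !inE eqxx ?orbT.
Qed.

Lemma orth_frame_stable : (J @: U <= U)%VS.
Proof.
apply/subvP=> _ /memv_imgP[z zU ->]; apply/mem_frame_orth.
by rewrite -!wJ !JK !skewNl !(orth_frame zU) !oppr0.
Qed.

Lemma frame_direct_sum :
  complex_symplectic_direct_sum J w (restr_form w U) (restr_form wV <<frame>>).
Proof.
have orthUF : {in U & <<frame>>%VS, forall x y, w x y = 0}.
  by move=> x y /mem_orthovP; apply.
have wVE (x y : subvs_of <<frame>>) :
    restr_form wV <<frame>> x y = w (vsval x) (vsval y).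
  exact: frame_form (subvsP x) (subvsP y).
split.
- by rewrite frame_direct frame_full.
- by rewrite frame_stable orth_frame_stable.
- apply: (orth_restr_cs Jw (B := <<frame>>)) frame_full _ orthUF _ => //.
  exact: orth_frame_stable.
- apply: (orth_restr_cs Jw (B := U)) frame_stable _ wVE.
    by rewrite addvC frame_full.
  by move=> x y xF yU; rewrite skewC orthUF ?oppr0.
- move=> x x' y y'.
  transitivity (w (vsval x) (vsval x') + w (vsval y) (vsval y')).
    rewrite !skewE [w (vsval y) _]skewC.
    rewrite (orthUF _ _ (subvsP x) (subvsP y')).
    rewrite (orthUF _ _ (subvsP x') (subvsP y)).
    by rewrite oppr0 addr0 add0r.
  by congr (_ + _); apply/esym/wVE.
Qed.

(** The left-hand side is an endomorphism, from which the block of [F] on [U] is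
    built; the right-hand side is what is computed with. *)
Lemma frame_residueE v : daddv_pi U <<frame>> v = v - frame_proj v.
Proof.
have /directv_addP UF0 := frame_direct.
have piF : daddv_pi U <<frame>> (frame_proj v) = 0.
  apply: (addIr (daddv_pi <<frame>> U (frame_proj v))).
  rewrite daddv_pi_add ?frame_full ?memvf // add0r.
  by rewrite daddv_pi_id ?frame_proj_mem // capvC.
rewrite -{1}(subrK (frame_proj v) v) linearD /= piF addr0.
by rewrite daddv_pi_id ?sub_frame_proj_orth.
Qed.

(** * The normal form of a skew endomorphism of a hyperplane *)

Section BlockMatrix.
Variables (u : {vspace g}) (F : 'End(g)).
Hypothesis mem_u : forall v, (v \in u) = (w Y v == 0).
Hypothesis F_u : (F @: u <= u)%VS.

Let w_YE v : v \in u -> w Y v = 0.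
Proof. by rewrite mem_u => /eqP. Qed.

(** The coefficient [- w Y v] of [X] in [frame_proj v] vanishes on [u]. *)
Lemma block_decomposition v : v \in u ->
  exists2 z, z \in U & exists r s,
    v = z + r *: Y + s *: J Y + w (J Y) v *: J X.
Proof.
move=> vu; exists (v - frame_proj v); first exact: sub_frame_proj_orth.
exists (w X v), (- w (J X) v).
rewrite -{1}(subrK (frame_proj v) v) {2}/frame_proj w_YE //.
by rewrite scale0r subr0 scaleNr !addrA.
Qed.

(** In the expansion of [w (F x) y + w x (F y)] the terms in [p] cancel by
    skewness of [w], those in [a] because [F] has [a] on [JY] and [- a] on [JX],
    and those in [h] because [h] lies in sp.  On vectors [x] with [x] and [J x]
    in [u] there is no [JX] component, and the two rows [w (Jp) .] and [w p .]
    are exchanged by [J] just as [Y] and [JY] are. *)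
Lemma block_matrix_sufficient a b c (p : subvs_of U) (h : 'End(subvs_of U)) :
  in_sp (restr_form w U) (restr_end U J) h ->
  has_block_matrix J w X Y (restr_end u F) a b c p h ->
  {in u &, forall x y, w (F x) y + w x (F y) = 0} /\
  (forall x, x \in u -> J x \in u -> F (J x) = J (F x)).
Proof.
case=> hJ h_skew blk.
have FE (z : subvs_of U) r s t :
    F (vsval z + r *: Y + s *: J Y + t *: J X) =
      (vsval (h z) + t *: vsval p)
      + (w (J (vsval p)) (vsval z) + a * r + b * t) *: Y
      + (w (vsval p) (vsval z) + a * s + c * t) *: J Y
      + (- a * t) *: J X.
  set v := vsval z + _ + _ + _.
  have vu : v \in u.
    rewrite mem_u /v !skewE !frame_pairings !(orth_frame (subvsP z)).
    by rewrite !mulr0 !addr0.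
  by rewrite -(blk (vsproj u v) z r s t) ?restr_endE ?vsprojK.
split=> [x y xu yu | x xu Jxu].
  have [z zU [r [s ->]]] := block_decomposition xu; move: (w (J Y) x) => t.
  have [z' z'U [r' [s' ->]]] := block_decomposition yu; move: (w (J Y) y) => t'.
  have hzz' : w (vsval (h (vsproj U z))) (vsval (vsproj U z'))
      + w (vsval (vsproj U z)) (vsval (h (vsproj U z'))) = 0 by exact: h_skew.
  move: hzz'; rewrite !vsprojK // => hzz'.
  have := FE (vsproj U z) r s t; rewrite vsprojK // => ->.
  have := FE (vsproj U z') r' s' t'; rewrite vsprojK // => ->.
  have hzU := subvsP (h (vsproj U z)); have hz'U := subvsP (h (vsproj U z')).
  rewrite !skewE !frame_pairings !(orth_frame zU, orth_frame z'U).
  rewrite !(orth_frame hzU, orth_frame hz'U, orth_frame (subvsP p)).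
  by rewrite [w z (vsval p)]skewC -[RHS]hzz'; ring.
have [z zU [r [s xE]]] := block_decomposition xu.
have Jz : J z \in U by apply: (subvP orth_frame_stable); rewrite memv_img.
(* The JX coefficient of x is w (JY) x = w Y (Jx), zero as Jx is in u. *)
have x0 : w (J Y) x = 0 by rewrite wJ w_YE.
rewrite xE x0 scale0r addr0.
have := FE (vsproj U z) r s 0; rewrite vsprojK // scale0r addr0 => ->.
have -> : J (z + r *: Y + s *: J Y) = J z + (- s) *: Y + r *: J Y.
  by rewrite !(cs_linear J) JK scalerN scaleNr addrAC.
have := FE (vsproj U (J z)) (- s) r 0; rewrite vsprojK // scale0r addr0 => ->.
have -> : vsval (h (vsproj U (J z))) = J (vsval (h (vsproj U z))).
  have := congr1 (fun k : 'End(subvs_of U) => vsval (k (vsproj U z))) hJ.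
  rewrite /= !comp_lfunE [in RHS]restr_endE ?orth_frame_stable // => <-.
  congr (vsval (h _)); apply: subvs_inj.
  by rewrite restr_endE ?orth_frame_stable // !vsprojK.
apply: (cs_inj Jw) => y.
rewrite !(cs_linear J) !skewE !JK !skewE -[w (vsval p) (J z)]wJ.
by rewrite [w (J (vsval p)) (J z)]wJ JK skewNr; ring.
Qed.

(** Skewness determines each column of [F] from the pairings of its values with
    the frame: [Y] spans the radical of [w] on [u], hence is an eigenvector;
    [JY] follows by commutation; the rows on [U] are the transposes of the column
    of [JX], twisted by [J] for the [Y] row. *)
Lemma block_matrix_necessary :
  {in u &, forall x y, w (F x) y + w x (F y) = 0} ->
  (forall x, x \in u -> J x \in u -> F (J x) = J (F x)) ->
  exists (a b c : R) (p : subvs_of U) (h : 'End(subvs_of U)),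
    in_sp (restr_form w U) (restr_end U J) h /\
    has_block_matrix J w X Y (restr_end u F) a b c p h.
Proof.
move=> F_skew FJ.
have Fin x : x \in u -> F x \in u.
  by move=> xu; apply: (subvP F_u); rewrite memv_img.
have Yu : Y \in u by rewrite mem_u frame_pairings.
have JYu : J Y \in u by rewrite mem_u frame_pairings.
have JXu : J X \in u by rewrite mem_u frame_pairings.
have Uu z : z \in U -> z \in u by move=> zU; rewrite mem_u (orth_frame zU).
have JU z : z \in U -> J z \in U.
  by move=> zU; apply: (subvP orth_frame_stable); rewrite memv_img.
have skew_swap x y : x \in u -> y \in u -> w (F x) y = - w x (F y).
  by move=> xu yu; apply/eqP; rewrite -addr_eq0; apply/eqP/F_skew.
(* F Y is orthogonal to u, since w (F Y) t = - w Y (F t) for t in u; adding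
   w Y t *: X moves an arbitrary t into u because w Y X = -1. *)
have FYE : F Y = w X (F Y) *: Y.
  apply: (cs_inj Jw) => t.
  have tu : t + w Y t *: X \in u.
    by rewrite mem_u !skewE YX mulrN1 subrr.
  have FYt : w (F Y) (t + w Y t *: X) = 0.
    by rewrite skew_swap // (w_YE (Fin _ tu)) oppr0.
  move: FYt; rewrite !skewE [w (F Y) X]skewC mulrN => /eqP.
  by rewrite subr_eq0 mulrC => /eqP.
set a := w X (F Y) in FYE.
have FJYE : F (J Y) = a *: J Y by rewrite FJ // FYE linearZ.
pose b := w X (F (J X)); pose c := - w (J X) (F (J X)).
pose p := vsproj U (daddv_pi U <<frame>> (F (J X))).
have pE : vsval p = daddv_pi U <<frame>> (F (J X)) by rewrite vsprojK ?memv_pi.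
pose h := restr_end U (daddv_pi U <<frame>> \o F)%VF.
have hE z : vsval (h z) = daddv_pi U <<frame>> (F (vsval z)).
  rewrite restr_endE ?comp_lfunE //.
  by apply/subvP=> _ /memv_imgP[x _ ->]; rewrite comp_lfunE memv_pi.
have FJXE : F (J X) = vsval p + b *: Y + c *: J Y + (- a) *: J X.
  rewrite -[LHS](subrK (frame_proj (F (J X)))) -frame_residueE -pE.
  rewrite {1}/frame_proj.
  rewrite (w_YE (Fin _ JXu)) scale0r subr0.
  have -> : w (J Y) (F (J X)) = - a.
    apply: oppr_inj; rewrite -skew_swap // FJYE skewZl frame_pairings.
    by rewrite mulr1 opprK.
  by rewrite /b /c [in RHS](scaleNr _ (J Y)) !addrA.
have FUE z : z \in U -> F z = vsval (h (vsproj U z))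
    + w (J (vsval p)) z *: Y + w (vsval p) z *: J Y.
  move=> zU; have zu := Uu z zU.
  have JXF x : x \in U -> w (J X) (F x) = - w (vsval p) x.
    move=> xU; rewrite skewC (skew_swap _ _ (Uu _ xU) JXu) opprK FJXE !skewE.
    by rewrite !(orth_frame xU) !mulr0 !addr0 skewC.
  (* Commutation with J turns the Y coefficient at z into the JY one at J z. *)
  have XF : w X (F z) = w (J (vsval p)) z.
    have -> : F z = - J (J (F z)) by rewrite JK opprK.
    rewrite skewNr -wJ -FJ ?Uu ?JU // JXF ?JU //.
    by rewrite opprK wJ.
  have JYF : w (J Y) (F z) = 0.
    apply: oppr_inj; rewrite -skew_swap ?FJYE // skewZl.
    by rewrite (orth_frame zU) mulr0 oppr0.
  rewrite hE vsprojK // frame_residueE /frame_proj (w_YE (Fin _ zu)) XF JYF.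
  rewrite JXF // !scale0r subr0 addr0 scaleNr opprK -addrA.
  by rewrite subrK.
exists a, b, c, p, h; split.
  split=> [|x y].
    (* Compare the U components of F (J x) and J (F x). *)
    apply/lfunP=> x; apply: subvs_inj.
    rewrite !comp_lfunE [in RHS]restr_endE ?orth_frame_stable //.
    have xU := subvsP x.
    have := FUE _ (JU _ xU); rewrite FJ ?Uu ?JU // (FUE _ xU).
    rewrite vsvalK !(cs_linear J) JK -[w (vsval p) (J _)]wJ.
    rewrite [w (J (vsval p)) (J _)]wJ JK skewNr scalerN scaleNr -!addrA.
    rewrite [in RHS](addrC (- _)) => /addIr ->.
    congr (vsval (h _)); apply: subvs_inj.
    by rewrite restr_endE ?orth_frame_stable // vsprojK ?JU.
  have xU := subvsP x; have yU := subvsP y.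
  have := F_skew _ _ (Uu _ xU) (Uu _ yU).
  rewrite (FUE _ xU) (FUE _ yU) !vsvalK !skewE.
  by rewrite !(orth_frame xU, orth_frame yU) !mulr0 !addr0.
move=> v z r s t vE; have zU := subvsP z.
rewrite restr_endE // vE !linearD !linearZ /= FYE FJYE FJXE (FUE _ zU) vsvalK.
apply: (cs_inj Jw) => y; rewrite !skewE; ring.
Qed.

End BlockMatrix.

End Frame.

(** * Hyperplanes of a complex symplectic space *)

Section Hyperplane.
Variables (R : fieldType) (g : vectType R) (u : {vspace g}) (X : g).
Hypothesis u_codim1 : (\dim u).+1 = \dim {:g}.
Hypothesis X_notin : X \notin u.

(** If the sum were not everything it would have the dimension of [u], hence
    equal [u] and contain [X]. *)
Lemma line_complement : (u + <[X]>)%VS = fullv.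
Proof.
apply/eqP; rewrite eqEdim subvf -u_codim1 ltnNge.
apply: contra X_notin => le_dim.
have := dimv_leqif_sup (addvSl u <[X]>).
case=> le_u /esym; rewrite eqn_leq le_u le_dim => /(subv_trans (addvSr _ _)).
by rewrite memvE.
Qed.

Lemma line_complementP v : exists2 v0, v0 \in u & exists k, v = v0 + k *: X.
Proof.
have /memv_addP[v0 v0u [_ /vlineP[k ->] ->]] : v \in (u + <[X]>)%VS.
  by rewrite line_complement memvf.
by exists v0 => //; exists k.
Qed.

Section HyperplaneOrth.
Variables (J : 'End(g)) (w : {skew_symmetric g}) (Y : g).
Hypotheses (Jw : complex_symplectic_space J w) (char2 : (2 : R) != 0).
Hypotheses (Y_in : Y \in orthov w u) (YX : w Y X = -1).

Lemma mem_hyperplane v : (v \in u) = (w Y v == 0).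
Proof.
have wY := mem_orthovP Y_in.
have [v0 v0u [k ->]] := line_complementP v.
rewrite (rpredDl _ v0u) skewE skewZr YX wY // add0r mulrN1 oppr_eq0.
by rewrite rpredZeq (negbTE X_notin) orbF.
Qed.

(** A vector orthogonal to [u] is determined by its pairing with [X]. *)
Lemma orth_hyperplane : orthov w u = <[Y]>%VS.
Proof.
apply/eqP; rewrite eqEsubv -memvE Y_in andbT; apply/subvP => x /mem_orthovP xu.
apply/vlineP; exists (- w x X); apply: (cs_inj Jw) => t.
have [t0 t0u [k ->]] := line_complementP t.
by rewrite !skewE xu // (mem_orthovP Y_in) // YX; ring.
Qed.

(** Stability under [J] turns orthogonality to [X] and [Y] into orthogonality to
    the whole frame.  Conversely a vector orthogonal to the frame is in
    particular orthogonal to [Y], so it lies in [u], and pairing its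
    decomposition with the frame shows that only its part in [U] is nonzero. *)
Lemma complement_orth_frame (U : {vspace g}) :
  u = (U + <[Y]> + <[J Y]> + <[J X]>)%VS -> (J @: U <= U)%VS ->
  (U <= orthov w <[X]>)%VS ->
  U = orthov w <<frame J X Y>>%VS.
Proof.
move=> u_split JU UX.
have Uu : (U <= u)%VS by rewrite u_split -!addvA addvSl.
have wJ := cs_J Jw.
have JXu : J X \in u by rewrite u_split memvE addvSr.
have YJX : w Y (J X) = 0 by apply: (mem_orthovP Y_in).
have UF z : z \in U -> z \in orthov w <<frame J X Y>>%VS.
  move=> zU; apply/mem_frame_orth.
  have JzU : J z \in U by apply: (subvP JU); rewrite memv_img.
  have X0 x : x \in U -> w X x = 0.
    by move=> xU; rewrite skewC (orthovP UX) ?memv_line ?oppr0.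
  have Y0 x : x \in U -> w Y x = 0.
    by move=> xU; rewrite (mem_orthovP Y_in) // (subvP Uu).
  by rewrite !wJ !X0 ?Y0.
apply/eqP; rewrite eqEsubv; apply/andP; split; apply/subvP=> // v vF.
have : v \in u by rewrite mem_hyperplane (orth_frame vF).
rewrite u_split => /memv_addP[v1 + [_ /vlineP[t ->] vE]].
case/memv_addP=> v2 + [_ /vlineP[s ->] v1E].
case/memv_addP=> z zU [_ /vlineP[r ->] v2E].
have zF := UF _ zU; move: (vF); rewrite vE v1E v2E => /mem_frame_orth.
rewrite !skewE !(orth_frame zF) !(frame_pairings Jw char2 YX YJX).
rewrite !(mulr0, mulr1, mulrN1, addr0, add0r).
move=> [_ -> -> /eqP]; rewrite oppr_eq0 => /eqP ->.
by rewrite !scale0r !addr0.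
Qed.

End HyperplaneOrth.

End Hyperplane.

(** * Almost abelian Lie algebras *)

Section AlmostAbelian.
Variables (R : fieldType) (g : vectType R) (br : lie_bracket g).
Variables (u : {vspace g}) (X : g).
Hypothesis u_ideal : abelian_ideal br u.
Hypothesis u_codim1 : (\dim u).+1 = \dim {:g}.
Hypothesis X_notin : X \notin u.
Let line_complementP := line_complementP u_codim1 X_notin.

Lemma ideal_br0 : {in u &, forall x y, br x y = 0}.
Proof. by case: u_ideal. Qed.

(** All brackets within [u] vanish, so only the triples with one entry [X] give
    a condition; for those with two entries [X] the terms cancel in pairs. *)
Lemma closed_iff_ad_skew (w : {skew_symmetric g}) :
  (forall x y z, ce_diff2 br w x y z = 0) <->
  {in u &, forall x y, w (br X x) y + w x (br X y) = 0}.
Proof.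
split=> [dw0 x y xu yu | adS x y z].
  have := dw0 X x y; rewrite /ce_diff2 (ideal_br0 xu yu) linear0l subr0.
  by rewrite [w (br X y) x]skewC => /eqP; rewrite -opprD oppr_eq0 => /eqP.
have [x0 x0u [i ->]] := line_complementP x.
have [y0 y0u [j ->]] := line_complementP y.
have [z0 z0u [k ->]] := line_complementP z.
have ad_swap a b : a \in u -> b \in u -> w (br X a) b = w (br X b) a.
  move=> au bu; have /eqP := adS _ _ au bu.
  by rewrite [w a _]skewC subr_eq0 => /eqP.
rewrite /ce_diff2 !brE.
rewrite !(ideal_br0 x0u y0u, ideal_br0 x0u z0u, ideal_br0 y0u z0u).
rewrite !lie_alt [br x0 X]brC [br y0 X]brC !skewE !linear0l.
by rewrite (ad_swap y0 x0) // (ad_swap z0 x0) // (ad_swap z0 y0) //; ring.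
Qed.

Section Integrability.
Variables (J : 'End(g)) (w : {skew_symmetric g}).
Hypothesis Jw : complex_symplectic_space J w.
Hypothesis JX_in : J X \in u.

Let JK := cs_JK Jw.
Let wJ := cs_J Jw.

(** If [J v0] has [X]-coefficient [j], then adding [j *: J X] to [v0] removes
    it, as [J (J X) = - X]. *)
Lemma complex_hyperplaneP v : exists2 v1, v1 \in u /\ J v1 \in u &
  exists i j, v = v1 + i *: X + j *: J X.
Proof.
have [v0 v0u [i ->]] := line_complementP v.
have [v1 v1u [j Jv0]] := line_complementP (J v0).
exists (v0 + j *: J X).
  by rewrite rpredD ?rpredZ // linearD linearZ /= JK scalerN Jv0 addrK.
by exists i, (- j); rewrite scaleNr addrAC addrK.
Qed.

(** For [x] in [u] with [J x] in [u], the tensor at [(X, x)] reduces to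
    [br X x + J (br X (J x))], all other brackets being inside [u].  The
    other values vanish or reduce to this one, because the tensor is alternating
    and antilinear with respect to [J]. *)
Lemma integrable_iff_ad_comm :
  (forall x y, nijenhuis br J x y = 0) <->
  (forall x, x \in u -> J x \in u -> br X (J x) = J (br X x)).
Proof.
split=> [N0 x xu Jxu | adJ x y].
  have := N0 X x; rewrite /nijenhuis (ideal_br0 JX_in xu).
  rewrite (ideal_br0 JX_in Jxu) linear0 addr0 subr0 => /(congr1 J).
  by rewrite linearD linear0 /= JK => /eqP; rewrite subr_eq0 eq_sym => /eqP.
have [x1 [x1u Jx1u] [i [i' ->]]] := complex_hyperplaneP x.
have [y1 [y1u Jy1u] [j [j' ->]]] := complex_hyperplaneP y.
apply: (cs_eq0 Jw) => t.
rewrite /nijenhuis !cs_linear !JK !brE.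
rewrite !(ideal_br0 x1u y1u, ideal_br0 x1u Jy1u, ideal_br0 Jx1u y1u).
rewrite !(ideal_br0 Jx1u Jy1u, ideal_br0 x1u JX_in, ideal_br0 Jx1u JX_in).
rewrite !(ideal_br0 JX_in y1u, ideal_br0 JX_in Jy1u).
rewrite !lie_alt.
rewrite [br x1 X]brC [br (J x1) X]brC [br (J X) X]brC.
rewrite (adJ x1) // (adJ y1) //.
rewrite !(cs_linear, scaler0, addr0, add0r).
by rewrite !skewE !wJ !JK !linear0l !skewE; ring.
Qed.

End Integrability.

End AlmostAbelian.

Theorem theorem3p10 (R : realType) (n : nat) (g : vectType R)
    (br : lie_bracket g) (u : {vspace g}) (J : 'End(g))
    (w : {skew_symmetric g}) (u' : {vspace g}) (X Y : g)
    (uperp := orthov w u)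
    (u'J := (u' :&: J @: u')%VS)
    (V := (uperp + J @: uperp + <<[:: J X; X]>>)%VS)
    (f := restr_end u (ad br X))
    (dim_g : \dim {:g} = (4 * n)%N)
    (u_ideal : abelian_ideal br u)
    (u_codim1 : (\dim u).+1 = \dim {:g})
    (Jw : complex_symplectic_space J w)
    (u'_direct : directv (uperp + u')%VS)
    (u'_compl : (uperp + u')%VS = u)
    (u'_J : (J @: uperp <= u')%VS)
    (X_notin : X \notin u)
    (X_orth : X \in orthov w u')
    (u_direct : directv (u'J + uperp + J @: uperp + <[J X]>)%VS)
    (u_split : u = (u'J + uperp + J @: uperp + <[J X]>)%VS)
    (Y_in : Y \in uperp)
    (Y_neq0 : Y != 0)
    (Y_norm : w (J Y) (J X) = 1) :
  [/\ directv (uperp + J @: uperp + <<[:: J X; X]>>)%VS /\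
        V = <<[:: Y; J Y; J X; X]>>%VS,
      exists al be : dual g,
        let Jal := pullback J al in
        let Jbe := pullback J be in
        let wV := sub_form (wedge Jal Jbe) (wedge al be) in
        [/\ basis_of V [:: Y; J Y; X; J X],
            dual_family [tuple Y; J Y; X; J X] [tuple al; - Jal; be; - Jbe],
            spans_annihilator u'J [:: al; - Jal; be; - Jbe]
          & complex_symplectic_direct_sum J w
              (restr_form w u'J) (restr_form wV V)]
    & complex_symplectic_structure br J w <->
      exists (a b c : R) (p : subvs_of u'J) (h : 'End(subvs_of u'J)),
        in_sp (restr_form w u'J) (restr_end u'J J) h /\
        has_block_matrix J w X Y f a b c p h].
Proof.
have char2 : (2 : R) != 0 by rewrite Num.Theory.pnatr_eq0.
have JK := cs_JK Jw; have wJ := cs_J Jw.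
have YX : w Y X = -1 by rewrite -Y_norm wJ JK skewNr opprK.
have JXu : J X \in u by rewrite u_split memvE addvSr.
have YJX : w Y (J X) = 0 by apply: (mem_orthovP Y_in).
have uperpE : uperp = <[Y]>%VS by apply: orth_hyperplane Jw Y_in YX.
have JuperpE : (J @: uperp = <[J Y]>)%VS by rewrite uperpE limg_line.
have VE : V = <<frame J X Y>>%VS.
  rewrite /V JuperpE uperpE /frame !span_cons span_nil !addv0 -!addvA.
  by rewrite (addvC <[J X]>%VS).
have u'JE : u'J = orthov w <<frame J X Y>>%VS.
  apply: (complement_orth_frame u_codim1 X_notin Jw char2 Y_in YX).
  - by rewrite {1}u_split JuperpE uperpE.
  - apply/subvP=> _ /memv_imgP[x /memv_capP[xu' /memv_imgP[y yu' xE]] ->].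
    by rewrite memv_cap memv_img // andbT xE JK rpredN.
  - by rewrite (subv_trans (capvSl _ _)) // -mem_orthov_sym.
have [ad_u u_abelian] := u_ideal.
have F_u : (ad br X @: u <= u)%VS.
  by apply/subvP=> _ /memv_imgP[x xu ->]; rewrite lfunE ad_u.
have mem_u := mem_hyperplane u_codim1 X_notin Y_in YX.
split.
- split; last by rewrite VE; apply/eq_span=> x; rewrite !inE (orbC (x == X)).
  (* The sum has the dimension 4 of the frame, and its terms at most 1, 1, 2. *)
  rewrite directvEgeq /=.
  have -> : \dim (uperp + J @: uperp + <<[:: J X; X]>>)%VS = 4%N.
    by rewrite -/V VE; exact: size_basis (frame_basis Jw char2 YX YJX).
  rewrite JuperpE uperpE !dim_vline.
  apply: (@leq_trans (1 + 1 + 2)%N) => //.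
  by rewrite !leq_add ?leq_b1 ?dim_span.
- exists (pairing_covector w X), (- pairing_covector w Y).
  (* Forms on V and u'J depend on these subspaces, which must therefore be
     replaced as a whole rather than rewritten. *)
  clearbody V u'J; subst V u'J; split.
  + exact: (frame_basis Jw char2 YX YJX).
  + exact: (frame_dual_family Jw char2 YX YJX).
  + exact: (frame_spans_annihilator Jw char2 YX YJX).
  + exact: (frame_direct_sum Jw char2 YX YJX).
clearbody u'J; subst u'J.
split=> [[_ N0 dw0] | [a [b [c [p [h [h_sp blk]]]]]]].
  apply: block_matrix_necessary => //.
  - move=> x y xu yu; rewrite !lfunE.
    have [+ _] := closed_iff_ad_skew u_ideal u_codim1 X_notin w.
    by move=> /(_ dw0); apply.
  - move=> x xu Jxu; rewrite !lfunE.
    have [+ _] := integrable_iff_ad_comm u_ideal u_codim1 X_notin Jw JXu.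
    by move=> /(_ N0); apply.
have [F_skew FJ] := block_matrix_sufficient Jw char2 YX YJX mem_u F_u h_sp blk.
split=> //.
- apply/(integrable_iff_ad_comm u_ideal u_codim1 X_notin Jw JXu) => x xu Jxu.
  by have := FJ _ xu Jxu; rewrite !lfunE.
- apply/(closed_iff_ad_skew u_ideal u_codim1 X_notin w) => x y xu yu.
  by have := F_skew _ _ xu yu; rewrite !lfunE.
Qed.
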